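(* Suppose $H$ is a subgroup of $PL_o(I)$. If $H$ is virtually solvable, then $H$ is solvable.
   Context: $PL_o(I)$ denotes the group, under composition, of orientation-preserving piecewise-linear homeomorphisms of the unit interval $I=[0,1]$ which admit finitely many breaks in slope. *)

(* Defs.v *)
From HB Require Import structures.
From mathcomp Require Import all_boot all_order all_algebra.
From mathcomp Require Import all_classical all_reals all_analysis.
Import Order.TTheory GRing.Theory Num.Theory.
Import numFieldNormedType.Exports.

Set Implicit Arguments.
Unset Strict Implicit.
Unset Printing Implicit Defensive.

Local Open Scope classical_set_scope.

Section AbstractGroups.
Local Open Scope group_scope.
Variable G : groupType.
Implicit Types H K : set G.

Definition subgroup H : Prop := group_closed (mem H).

Definition subgroup_gen (A : set G) : set G := smallest subgroup A.

Definition derived_subgroup H : set G :=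
  subgroup_gen [set [~ x, y] | x in H & y in H].

Definition derived_series H (n : nat) : set G := iter n derived_subgroup H.

Definition solvable_group H : Prop := exists n, derived_series H n = [set 1].

Definition finite_index K H : Prop :=
  finite_set [set [set h * k | k in K] | h in H].

Definition virtually_solvable H : Prop :=
  exists K, [/\ subgroup K, K `<=` H, finite_index K H & solvable_group K].

End AbstractGroups.

Definition homeomorphism (T U : topologicalType) (f : T -> U) : Prop :=
  continuous f /\ exists g : U -> T, [/\ continuous g, cancel f g & cancel g f].

Section PLo.
Local Open Scope ring_scope.
Variable R : realType.

Definition unit_itv : set R := `[0, 1].

(* The coercion of a set to a type equips I with the subspace topology. *)
Notation I := (set_type unit_itv).

Implicit Types (f g : I -> I) (a b x y : I).

Definition affine_between f (a b : R) : Prop :=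
  exists m c : R,
    forall x, a <= set_val x <= b -> set_val (f x) = m * set_val x + c.

(* If s = [:: t_1; ...; t_n], the partition is 0 = t_0 < t_1 < ... < t_n = 1. *)
Definition piecewise_linear f : Prop :=
  exists s : seq R, itv_partition 0 1 s /\
    forall i, (i < size s)%N -> affine_between f (nth 0 (0 :: s) i) (nth 0 s i).

Definition orientation_preserving f : Prop :=
  {homo f : x y / set_val x < set_val y}.

Record PLo : Type := MkPLo {
  PLo_fun :> I -> I;
  PLo_homeo : homeomorphism PLo_fun;
  PLo_orient : orientation_preserving PLo_fun;
  PLo_pl : piecewise_linear PLo_fun }.

Lemma PLo_ext (f g : PLo) : PLo_fun f = PLo_fun g -> f = g.
Proof.
case: f g => [f f1 f2 f3] [g g1 g2 g3] /= e; subst g.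
by congr MkPLo; exact: Prop_irrelevance.
Qed.

(* Finitely many breaks, without ordering them into a partition: this form is
   the one that is stable under composition and inversion. *)
Definition break_set f (B : seq R) : Prop :=
  forall a b, set_val a <= set_val b ->
    (forall t, t \in B -> ~~ (set_val a < t < set_val b)) ->
    affine_between f (set_val a) (set_val b).

Lemma unit_itvP x : 0 <= set_val x <= 1.
Proof. by have := set_mem (valP x); rewrite /unit_itv /= in_itv. Qed.

Lemma unit_itv0 : (0 : R) \in unit_itv.
Proof. by apply/mem_set; rewrite /unit_itv /= in_itv /= lexx ler01. Qed.

Definition clamp (t : R) : I := insubd (exist _ 0 unit_itv0 : I) t.

Lemma clampK t : 0 <= t <= 1 -> set_val (clamp t) = t.
Proof.
by move=> t01; apply: insubdK; apply/mem_set; rewrite /unit_itv /= in_itv.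
Qed.

Lemma affine_refl f (a b : R) : b <= a -> affine_between f a b.
Proof.
move=> ba; have [h|h] := boolP `[< exists x : I, a <= set_val x <= b >].
  have /asboolP [x xab] := h.
  exists 0, (set_val (f x)) => y yab; rewrite mul0r add0r.
  suff -> : y = x by [].
  apply: val_inj; move: xab yab => /andP[ax xb] /andP[ay yb].
  apply/eqP; rewrite eq_le; apply/andP; split.
    exact: le_trans yb (le_trans ba ax).
  exact: le_trans xb (le_trans ba ay).
exists 0, 0 => x xab; exfalso; move/asboolP: h; apply; by exists x.
Qed.

Lemma path_cell (t0 : R) s (a b : R) : path <%O t0 s -> t0 <= a -> a < b ->
  b <= last t0 s -> (forall t, t \in s -> ~~ (a < t < b)) ->
  exists2 i, (i < size s)%N & nth 0 (t0 :: s) i <= a /\ b <= nth 0 s i.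
Proof.
elim: s t0 => [|y s ih] t0 /=.
  by move=> _ t0a ab bt0 _; have := lt_le_trans ab (le_trans bt0 t0a);
     rewrite ltxx.
move=> /andP[t0y ys] t0a ab blast avoid.
have [by_|yb] := leP b y; first by exists 0%N.
have ya : y <= a.
  by rewrite leNgt; have := avoid y; rewrite mem_head yb andbT; apply.
have [|i si [h1 h2]] := ih y ys ya ab blast.
  by move=> t ts; apply: avoid; rewrite inE ts orbT.
by exists i.+1.
Qed.

Lemma pl_break f : piecewise_linear f -> exists B, break_set f B.
Proof.
move=> [s [[sp /eqP sl] sa]]; exists s => a b.
rewrite le_eqVlt => /orP[/eqP ->|ab] avoid; first exact: affine_refl.
have /andP[a0 _] := unit_itvP a; have /andP[_ b1] := unit_itvP b.
have [|i si [h1 h2]] := path_cell sp a0 ab _ avoid; first by rewrite sl.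
have [m [c h]] := sa i si; exists m, c => x /andP[ax xb].
by apply: h; rewrite (le_trans h1 ax) (le_trans xb h2).
Qed.

Lemma break_pl f B : break_set f B -> piecewise_linear f.
Proof.
move=> fB.
pose s : seq R := sort <=%O (undup [seq t <- 1 :: B | 0 < t <= 1]).
have ms (t : R) : (t \in s) = (0 < t <= 1) && (t \in 1 :: B).
  by rewrite mem_sort mem_undup mem_filter.
have s1 : 1 \in s by rewrite ms mem_head ltr01 lexx.
have ss : sorted <%O s by rewrite sort_lt_sorted undup_uniq.
have s0 : all (> 0) s by apply/allP => t; rewrite ms => /andP[/andP[]].
have sp : path <%O 0 s by rewrite lt_path_sortedE s0 ss.
have inc i j : (i < j)%N -> (j <= size s)%N ->
    nth 0 (0 :: s) i < nth 0 (0 :: s) j.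
  move=> ij js; apply: (sorted_ltn_nth (@lt_trans _ R) 0 (s := 0 :: s)) => //;
    rewrite !inE /= ltnS //; exact: leq_trans (ltnW ij) js.
have sl : last 0 s = 1.
  apply/eqP; rewrite eq_le.
  have sz : (0 < size s)%N by case: (s) s1.
  have -> /= : last 0 s <= 1.
    have : last 0 s \in s.
      by case: (s) sz => //= u v _; exact: mem_last.
    by rewrite ms => /andP[/andP[]].
  have -> : (1 : R) = nth 0 (0 :: s) (index 1 s).+1 by rewrite /= nth_index.
  have -> : last 0 s = nth 0 (0 :: s) (size s).
    by rewrite (last_nth 0).
  have := s1; rewrite -index_mem leq_eqVlt => /orP[/eqP->//|lt].
  by apply/ltW/inc.
exists s; split; first by split=> //; apply/eqP.
move=> i si.
have tb j : (j <= size s)%N -> 0 <= nth 0 (0 :: s) j <= 1.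
  case: j => [_|j js] /=; first by rewrite lexx ler01.
  by have := mem_nth 0 js; rewrite ms => /andP[/andP[/ltW -> ->]].
have ti := tb i (ltnW si); have ti1 := tb i.+1 si; rewrite /= in ti1.
have := fB (clamp (nth 0 (0 :: s) i)) (clamp (nth 0 s i)).
rewrite !clampK //; apply.
  by apply/ltW/(inc i i.+1).
move=> t tB; apply/negP => /andP[t1 t2].
have ts : t \in s.
  rewrite ms inE tB orbT andbT (le_lt_trans _ t1) /=; last by case/andP: ti.
  by rewrite (le_trans (ltW t2)) //; case/andP: ti1.
have et : nth 0 (0 :: s) (index t s).+1 = t by rewrite /= nth_index.
have it : (index t s < size s)%N by rewrite index_mem.
have [lt|le] := ltnP (index t s) i.
  have : t <= nth 0 (0 :: s) i.
    rewrite -et; move: lt; rewrite leq_eqVlt => /orP[/eqP->//|lt].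
    by apply/ltW/inc => //; exact: ltnW.
  by rewrite leNgt t1.
have : nth 0 (0 :: s) i.+1 <= t.
  rewrite -et; move: le; rewrite leq_eqVlt => /orP[/eqP->//|lt].
  by apply/ltW/inc.
by rewrite leNgt t2.
Qed.

Lemma orient_mono f : orientation_preserving f ->
  {mono f : x y / set_val x < set_val y}.
Proof.
move=> fo x y; apply/idP/idP; last exact: fo.
case: (ltgtP (set_val x) (set_val y)) => // [/fo h1 h2|/val_inj ->].
  by have := lt_trans h1 h2; rewrite ltxx.
by rewrite ltxx.
Qed.

Lemma orient_le f : orientation_preserving f ->
  {mono f : x y / set_val x <= set_val y}.
Proof. by move=> fo x y; rewrite !leNgt orient_mono. Qed.

Lemma orient_inv f g : orientation_preserving f -> cancel g f ->
  orientation_preserving g.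
Proof. by move=> fo gf x y xy; rewrite -(orient_mono fo) !gf. Qed.

Lemma between_clamp a b (t : R) :
  set_val a < t < set_val b -> set_val (clamp t) = t.
Proof.
move=> /andP[at_ tb]; apply: clampK.
have /andP[a0 _] := unit_itvP a; have /andP[_ b1] := unit_itvP b.
by rewrite (le_trans a0 (ltW at_)) (le_trans (ltW tb) b1).
Qed.

Lemma pl_inv f g : orientation_preserving f -> cancel f g -> cancel g f ->
  piecewise_linear f -> piecewise_linear g.
Proof.
move=> fo fg gf /pl_break[B fB].
have go := orient_inv fo gf.
apply: (@break_pl _ [seq set_val (f (clamp t)) | t <- B]) => a b ab avoid.
have [m [c h]] : affine_between f (set_val (g a)) (set_val (g b)).
  apply: fB; first by rewrite (orient_le go).
  move=> t tB; apply/negP => tab; have et := between_clamp tab.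
  have /negP := avoid _ (map_f (fun t => set_val (f (clamp t))) tB); apply.
  by rewrite -(orient_mono go a) -(orient_mono go _ b) fg et.
move: ab; rewrite le_eqVlt => /orP[/eqP->|ab]; first exact: affine_refl.
have m0 : m != 0.
  apply/eqP => m0; have gab : set_val (g a) <= set_val (g b).
    by rewrite (orient_le go) ltW.
  have := h (g a); have := h (g b); rewrite !lexx gab !gf m0 !mul0r.
  by move=> /(_ isT) eb /(_ isT) ea; move: ab; rewrite ea eb ltxx.
exists m^-1, (- (m^-1 * c)) => x axb.
have : set_val (g a) <= set_val (g x) <= set_val (g b).
  by rewrite !(orient_le go).
by move=> /h; rewrite gf => ->; rewrite mulrDr mulKf // addrK.
Qed.

Lemma pl_comp f g gi : orientation_preserving g -> cancel g gi ->
  cancel gi g -> piecewise_linear f -> piecewise_linear g ->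
  piecewise_linear (f \o g).
Proof.
move=> go ggi gig /pl_break[B fB] /pl_break[C gC].
apply: (@break_pl _ (C ++ [seq set_val (gi (clamp t)) | t <- B])).
move=> a b ab avoid.
have [m [c h]] : affine_between g (set_val a) (set_val b).
  by apply: gC => // t tC; apply: avoid; rewrite mem_cat tC.
have [m' [c' h']] : affine_between f (set_val (g a)) (set_val (g b)).
  apply: fB; first by rewrite (orient_le go).
  move=> t tB; apply/negP => tab; have et := between_clamp tab.
  have : set_val (gi (clamp t)) \in
      C ++ [seq set_val (gi (clamp t)) | t <- B].
    by rewrite mem_cat (map_f (fun t => set_val (gi (clamp t))) tB) orbT.
  by move=> /avoid/negP; apply;
     rewrite -(orient_mono go a) -(orient_mono go _ b) gig et.
exists (m' * m), (m' * c + c') => x axb /=.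
by rewrite h' ?(orient_le go) // h // mulrDr mulrA addrA.
Qed.

Lemma homeomorphism_id (T : topologicalType) : homeomorphism (@id T).
Proof. by split=> [x|]; [exact: cvg_id|exists id; split=> // x; exact: cvg_id]. Qed.

Lemma homeomorphism_comp (T U V : topologicalType) (h : U -> V) (k : T -> U) :
  homeomorphism h -> homeomorphism k -> homeomorphism (h \o k).
Proof.
move=> [hc [hi [hic h1 h2]]] [kc [ki [kic k1 k2]]]; split.
  by move=> x; apply: continuous_comp; [exact: kc|exact: hc].
exists (ki \o hi); split; [|exact: can_comp|exact: can_comp].
by move=> x; apply: continuous_comp; [exact: hic|exact: kic].
Qed.

Lemma piecewise_linear_id : piecewise_linear id.
Proof.
exists [:: 1]; split; first exact: (itv_partition1 ltr01).
by move=> i _; exists 1, 0 => x _; rewrite mul1r addr0.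
Qed.

Definition PLo_one : PLo :=
  MkPLo (homeomorphism_id I) (fun x y (xy : set_val x < set_val y) => xy)
    piecewise_linear_id.

Lemma PLo_mul_pl (f g : PLo) : piecewise_linear (f \o g).
Proof.
have [_ [gi [_ ggi gig]]] := PLo_homeo g.
exact: pl_comp (PLo_orient g) ggi gig (PLo_pl f) (PLo_pl g).
Qed.

Definition PLo_mul (f g : PLo) : PLo :=
  @MkPLo (f \o g) (homeomorphism_comp (PLo_homeo f) (PLo_homeo g))
    (fun x y xy => PLo_orient f (PLo_orient g xy)) (PLo_mul_pl f g).

Lemma PLo_inv_subproof (f : PLo) :
  exists h : PLo, cancel f h /\ cancel h f.
Proof.
have [fc [g [gc fg gf]]] := PLo_homeo f.
have gh : homeomorphism g by split=> //; exists f.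
by exists (MkPLo gh (orient_inv (PLo_orient f) gf)
  (pl_inv (PLo_orient f) fg gf (PLo_pl f))).
Qed.

Definition PLo_inv (f : PLo) : PLo := projT1 (cid (PLo_inv_subproof f)).

Lemma PLo_funK (f : PLo) : cancel f (PLo_inv f).
Proof. by rewrite /PLo_inv; case: cid => h []. Qed.

Lemma PLo_invK (f : PLo) : cancel (PLo_inv f) f.
Proof. by rewrite /PLo_inv; case: cid => h []. Qed.

Lemma PLo_mulA : associative PLo_mul.
Proof. by move=> f g h; exact: PLo_ext. Qed.

Lemma PLo_mul1 : left_id PLo_one PLo_mul.
Proof. by move=> f; exact: PLo_ext. Qed.

Lemma PLo_mulr1 : right_id PLo_one PLo_mul.
Proof. by move=> f; exact: PLo_ext. Qed.

Lemma PLo_mulV : left_inverse PLo_one PLo_inv PLo_mul.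
Proof. by move=> f; apply: PLo_ext; apply/funext => x; exact: PLo_funK. Qed.

Lemma PLo_mulrV : right_inverse PLo_one PLo_inv PLo_mul.
Proof. by move=> f; apply: PLo_ext; apply/funext => x; exact: PLo_invK. Qed.

HB.instance Definition _ := gen_eqMixin PLo.
HB.instance Definition _ := gen_choiceMixin PLo.
HB.instance Definition _ :=
  isGroup.Build PLo PLo_mulA PLo_mul1 PLo_mulr1 PLo_mulV PLo_mulrV.

End PLo.

(* Main.v *)
Require Import Defs.
From mathcomp Require Import all_boot all_order all_algebra.
From mathcomp Require Import all_classical all_reals all_analysis.
Import Order.TTheory GRing.Theory Num.Theory.

(** If [K] has finite index in [H], then every element of [H] has a positive
    power in [K]; this is all that is used of the finite index.  The claim
    proved is that a group [H] of piecewise linear homeomorphisms each of whose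
    elements has a positive power in a subgroup [K] with trivial [n]-th derived
    subgroup has itself a trivial [n]-th derived subgroup
    ([derived_series_root]).

    For [n = 0] this says that [PLo R] is torsion free: the powers of an
    increasing map move a point further and further in the same direction.  For
    the same reason [K] and [H] have the same common fixed points.

    For the inductive step, let [T] be the subgroup of the elements of [H]
    which are the identity near each common fixed point of [H].  A piecewise
    linear map is linear on either side of a fixed point, so commutators of
    elements of [H] have trivial germs there, and [T] contains the derived
    subgroup of [H].  By induction, applied to [T] and [K `&` T], it suffices
    to show that the derived length of [K `&` T] is less than that of [K].

    The key point is a displacement argument on a component [(c, d)] of the
    complement of the common fixed points.  An element [w] of [K `&` T] is
    supported, within [(c, d)], in a compact interval.  The orbits of [K] are
    unbounded in [(c, d)], since the least upper bound of an orbit is a fixed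
    point; so some [k] in [K] moves that interval off itself, and the commutator
    of [w^-1] and [k], which lies in the derived subgroup of [K], acts on the
    interval as [w] does.  Hence iterated commutators of elements of [K `&` T]
    agree, locally, with iterated commutators of [K] that are one level deeper
    ([derived_series_lift]), and the latter are eventually trivial. *)

Set Implicit Arguments.
Unset Strict Implicit.
Unset Printing Implicit Defensive.

Local Open Scope classical_set_scope.

(** * Subgroups and the derived series *)

Section AbstractGroup.
Local Open Scope group_scope.
Variable G : groupType.
Implicit Types (A B H K : set G) (x y : G).

Lemma subgroupP H : subgroup H <->
  [/\ H 1, forall x, H x -> H x^-1 & forall x y, H x -> H y -> H (x * y)].
Proof.
split=> [gH|[H1 HV HM]].
  split; first by case: gH => /set_mem.
    by move=> x Hx; apply/set_mem/(group_closedV gH)/mem_set.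
  by move=> x y Hx Hy; apply/set_mem/(group_closedM gH); exact/mem_set.
split; first exact/mem_set.
by move=> x y /set_mem Hx /set_mem Hy; apply/mem_set/HM => //; exact: HV.
Qed.

Lemma subgroupI H K : subgroup H -> subgroup K -> subgroup (H `&` K).
Proof.
move=> /subgroupP[H1 HV HM] /subgroupP[K1 KV KM]; apply/subgroupP; split=> //.
  by move=> x [Hx Kx]; split; [exact: HV|exact: KV].
by move=> x y [Hx Kx] [Hy Ky]; split; [exact: HM|exact: KM].
Qed.

Lemma subgroup_commg H x y : subgroup H -> H x -> H y -> H [~ x, y].
Proof.
move=> /subgroupP[_ HV HM] Hx Hy.
by apply: (HM); [exact: HV|apply: (HM); [exact: HV|exact: HM]].
Qed.

Lemma subgroup_gen_subgroup A : subgroup (subgroup_gen A).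
Proof.
apply/subgroupP; split.
- by move=> K [/subgroupP[]].
- by move=> x Ax K KA; have /subgroupP[_ KV _] := KA.1; exact: KV (Ax K KA).
- move=> x y Ax Ay K KA; have /subgroupP[_ _ KM] := KA.1.
  exact: KM (Ax K KA) (Ay K KA).
Qed.

Lemma subgroup_gen_min A H : subgroup H -> A `<=` H -> subgroup_gen A `<=` H.
Proof. by move=> gH AH; exact: smallest_sub. Qed.

Lemma derived_subgroup_commg H x y :
  H x -> H y -> derived_subgroup H [~ x, y].
Proof.
move=> Hx Hy; apply: sub_gen_smallest.
by exists x => //; exists y.
Qed.

Lemma derived_subgroup_min H K : subgroup K ->
  (forall x y, H x -> H y -> K [~ x, y]) -> derived_subgroup H `<=` K.
Proof.
move=> gK HK; apply: subgroup_gen_min => // _ [x Hx [y Hy <-]].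
exact: HK.
Qed.

Lemma derived_subgroupS H K : H `<=` K ->
  derived_subgroup H `<=` derived_subgroup K.
Proof.
move=> HK; apply: derived_subgroup_min; first exact: subgroup_gen_subgroup.
by move=> x y /HK Kx /HK Ky; exact: derived_subgroup_commg.
Qed.

Lemma derived_seriesS n H K : H `<=` K ->
  derived_series H n `<=` derived_series K n.
Proof. by move=> HK; elim: n => //= n IHn; exact: derived_subgroupS. Qed.

Lemma derived_series_subgroup n H : subgroup H -> subgroup (derived_series H n).
Proof. by case: n => // n _; exact: subgroup_gen_subgroup. Qed.

Lemma derived_series_succ n H :
  derived_series H n.+1 = derived_series (derived_subgroup H) n.
Proof. exact: iterSr. Qed.

Lemma derived_series_sub n H : subgroup H -> derived_series H n `<=` H.
Proof.
move=> gH; elim: n => //= n IHn; apply: derived_subgroup_min => // x y Hx Hy.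
by apply: subgroup_commg => //; exact: IHn.
Qed.

Lemma subgroup_set1 H : subgroup H -> H `<=` [set 1] -> H = [set 1].
Proof.
by move=> /subgroupP[H1 _ _] sH; apply/seteqP; split=> // x ->.
Qed.

(** By the pigeonhole principle, two of the cosets [h ^+ i K] coincide. *)
Lemma finite_index_expg H K : subgroup H -> subgroup K -> finite_index K H ->
  forall h, H h -> exists m, K (h ^+ m.+1).
Proof.
move=> gH gK fin h Hh; have /subgroupP[H1 _ HM] := gH.
have /subgroupP[K1 _ _] := gK.
have HX i : H (h ^+ i) by elim: i => [|i IHi] //; rewrite expgS; exact: HM.
pose u i : set G := [set h ^+ i * k | k in K].
have [ninj|inj] := pselect (exists i j, (i < j)%N /\ u i = u j).
  have [i [j [ij uij]]] := ninj; exists (j - i).-1.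
  have : u i (h ^+ j) by rewrite uij; exists 1 => //; rewrite mulg1.
  rewrite prednK ?subn_gt0 // => -[k Kk].
  by rewrite -{1}(subnKC (ltnW ij)) expgnDr => /mulgI <-.
exfalso; apply: infinite_nat.
have uinj : {in [set: nat] &, injective u}.
  move=> i j _ _ uij; case: (ltngtP i j) => // lt; exfalso; apply: inj.
    by exists i, j.
  by exists j, i.
rewrite -(eq_finite_set (inj_card_eq uinj)).
by apply: sub_finite_set fin => _ [i _ <-]; exists (h ^+ i).
Qed.

End AbstractGroup.

(** * Fixed points of groups of homeomorphisms of the interval *)

Section FixedPoints.
Local Open Scope ring_scope.
Variable R : realType.
Notation I := (set_type (@unit_itv R)).
Implicit Types (f g h k v w : PLo R) (H K D : set (PLo R)) (x y p q c d : I).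
Implicit Types A : set I.

Lemma PLo_mulE f g x : (f * g)%g x = f (g x). Proof. by []. Qed.
Lemma PLo_VK f x : (f^-1)%g (f x) = x. Proof. exact: PLo_funK. Qed.
Lemma PLo_KV f x : f ((f^-1)%g x) = x. Proof. exact: PLo_invK. Qed.

Lemma PLo_le f x y :
  (set_val (f x) <= set_val (f y)) = (set_val x <= set_val y).
Proof. exact: (orient_le (PLo_orient f)). Qed.

Lemma PLo_lt f x y : (set_val (f x) < set_val (f y)) = (set_val x < set_val y).
Proof. exact: (orient_mono (PLo_orient f)). Qed.

Lemma PLo_fixV f x : f x = x -> (f^-1)%g x = x.
Proof. by move=> fx; rewrite -{1}fx PLo_VK. Qed.

Lemma PLo_eq1 f : (forall x, f x = x) -> f = 1%g.
Proof. by move=> f1; apply: PLo_ext; apply/funext => x; exact: f1. Qed.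

(** A point moved by [h] is moved further in the same direction by the powers
    of [h]. *)
Lemma PLo_fix_root h m x : (h ^+ m.+1)%g x = x -> h x = x.
Proof.
move=> hm; case: (ltgtP (set_val (h x)) (set_val x)) => [lt|gt|/val_inj //].
- suff : set_val ((h ^+ m.+1)%g x) < set_val x by rewrite hm ltxx.
  elim: m {hm} => [//|m IHm]; rewrite expgS PLo_mulE.
  by apply: lt_trans lt; rewrite PLo_lt.
- suff : set_val x < set_val ((h ^+ m.+1)%g x) by rewrite hm ltxx.
  elim: m {hm} => [//|m IHm]; rewrite expgS PLo_mulE.
  by apply: lt_trans gt _; rewrite PLo_lt.
Qed.

Lemma interval_lub A : A !=set0 -> exists p,
  (forall a, A a -> set_val a <= set_val p) /\
  (forall q, (forall a, A a -> set_val a <= set_val q) ->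
    set_val p <= set_val q).
Proof.
move=> [a0 Aa0]; pose E : set R := [set set_val a | a in A].
have E0 : E !=set0 by exists (set_val a0), a0.
have ubE : ubound E 1 by move=> _ [a _ <-]; case/andP: (unit_itvP a).
have hE : has_ubound E by exists 1.
have le_sup a : A a -> set_val a <= sup E.
  by move=> Aa; apply: ub_le_sup => //; exists a.
have s01 : 0 <= sup E <= 1.
  rewrite ge_sup // andbT (le_trans _ (le_sup _ Aa0)) //.
  by case/andP: (unit_itvP a0).
exists (clamp (sup E)); rewrite clampK //; split=> // q ubq.
by apply: ge_sup => // _ [a Aa <-]; exact: ubq.
Qed.

(** The common fixed points of the elements of [H]. *)
Definition fixed_points H : set I := [set p | forall h, H h -> h p = p].

(** Each element of the group is an order automorphism that preserves [A],
    hence also its least upper bound. *)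
Lemma invariant_lub_fixed H A : subgroup H -> A !=set0 ->
  (forall h a, H h -> A a -> A (h a)) ->
  exists p, [/\ fixed_points H p, forall a, A a -> set_val a <= set_val p &
    forall q, (forall a, A a -> set_val a <= set_val q) ->
      set_val p <= set_val q].
Proof.
move=> /subgroupP[_ HV _] A0 HA; have [p [pub plub]] := interval_lub A0.
have lep h : H h -> set_val p <= set_val (h p).
  move=> Hh; apply: plub => a Aa.
  by rewrite -(PLo_KV h a) PLo_le; apply/pub/HA => //; exact: HV.
exists p; split=> // h Hh; apply: val_inj; apply/eqP; rewrite eq_le.
apply/andP; split; last exact: lep.
by have := lep _ (HV _ Hh); rewrite -(PLo_le h) PLo_KV.
Qed.

(** A point that is not fixed lies in an open interval with fixed end points
    and no fixed point inside. *)
Lemma fixed_gap H x : subgroup H -> ~ fixed_points H x -> exists c d,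
  [/\ fixed_points H c, fixed_points H d, set_val c < set_val x < set_val d &
    forall p, set_val c < set_val p < set_val d -> ~ fixed_points H p].
Proof.
move=> gH nx.
have [|h a Hh [Fa ax]|c [Fc cub club]] := @invariant_lub_fixed H
    [set p | fixed_points H p /\ set_val p <= set_val x] gH.
- (* The left end point of the unit interval is fixed. *)
  exists (clamp 0); split; last first.
    by rewrite clampK ?lexx ?ler01 //; case/andP: (unit_itvP x).
  move=> h Hh; apply: val_inj; apply/eqP; rewrite eq_le.
  have c0 : set_val (clamp 0 : I) = 0 by rewrite clampK // lexx ler01.
  apply/andP; split; last first.
    by rewrite [leLHS]c0; case/andP: (unit_itvP (h (clamp 0))).
  rewrite -{2}(PLo_KV h (clamp 0)) PLo_le c0.
  by case/andP: (unit_itvP ((h^-1)%g (clamp 0))).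
- by rewrite Fa.
(* [d] is the greatest lower bound of the fixed points to the right of [x],
   obtained as the least upper bound of their lower bounds. *)
have [|h a Hh aF p Fp xp|d [Fd dub dlub]] := @invariant_lub_fixed H
    [set q | forall p, fixed_points H p -> set_val x <= set_val p ->
       set_val q <= set_val p] gH.
- by exists x.
- by rewrite -(Fp _ Hh) PLo_le; exact: aF.
have cx : set_val c <= set_val x by apply: club => a [].
have xd : set_val x <= set_val d by exact: dub.
exists c, d; split=> //.
  (* [c] and [d] are fixed, hence distinct from [x]. *)
  rewrite !lt_neqAle cx xd !andbT.
  by apply/andP; split; apply/eqP => /val_inj e; apply: nx;
    [rewrite -e|rewrite e].
move=> p /andP[cp pd] Fp; have [px|xp] := leP (set_val p) (set_val x).
  by move: cp; rewrite ltNge cub.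
by move: pd; rewrite ltNge dlub // => a aF; exact/aF/ltW.
Qed.

(** Otherwise the least upper bound of the orbit of [c] would be a fixed point
    between [c] and [d]. *)
Lemma orbit_passes K c d : subgroup K ->
  (forall p, set_val c <= set_val p <= set_val d -> ~ fixed_points K p) ->
  exists2 k, K k & set_val d < set_val (k c).
Proof.
move=> gK nfix; have /subgroupP[K1 _ KM] := gK; apply: contrapT => nk.
have orbc : [set k c | k in K] c by exists 1%g.
have [|h _ Kh [k Kk <-]|p [Fp pub plub]] :=
    @invariant_lub_fixed K [set k c | k in K] gK.
- by exists c.
- by exists (h * k)%g => //; exact: KM.
apply: (nfix p) => //; rewrite pub // plub // => _ [k Kk <-].
by rewrite leNgt; apply/negP => dk; apply: nk; exists k.
Qed.

(** * Germs at fixed points *)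

(** On a one-sided neighbourhood of [p], the map [f] is affine and sends [p] to
    [p]; the side is the right one if [s = 1] and the left one if [s = -1]. *)
Definition linear_germ (s : R) (p : I) (f : I -> I) : Prop :=
  exists m e : R, 0 < e /\ forall x, 0 <= s * (set_val x - set_val p) < e ->
    set_val (f x) - set_val p = m * (set_val x - set_val p).

Lemma avoid_right (B : seq R) (a : R) :
  exists2 e, 0 < e & forall t, t \in B -> ~~ (a < t < a + e).
Proof.
elim: B => [|t B [e e0 eB]]; first by exists 1.
have [ta|at_] := leP t a.
  exists e => // u; rewrite inE => /orP[/eqP->|/eB //].
  by rewrite ltNge ta.
exists (Num.min e (t - a)); first by rewrite lt_min e0 subr_gt0.
move=> u; rewrite inE => /orP[/eqP->|/eB].
  by rewrite -ltrBlDl lt_min ltxx !andbF.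
by apply: contra => /andP[->]; rewrite -!ltrBlDl lt_min => /andP[->].
Qed.

Lemma avoid_left (B : seq R) (a : R) :
  exists2 e, 0 < e & forall t, t \in B -> ~~ (a - e < t < a).
Proof.
have [e e0 eB] := avoid_right [seq - t | t <- B] (- a).
exists e => // t /(map_f -%R)/eB; apply: contra => /andP[h1 h2].
by rewrite ltrN2 h2 ltrNl opprD opprK.
Qed.

Lemma affine_fixed_linear (f : I -> I) (a b : R) p :
  affine_between f a b -> a <= set_val p <= b -> f p = p ->
  exists m : R, forall x, a <= set_val x <= b ->
    set_val (f x) - set_val p = m * (set_val x - set_val p).
Proof.
move=> [m [c hf]] pab fp; exists m => x xab.
have pE := hf p pab; rewrite fp in pE.
by rewrite hf // [X in _ - X = _]pE opprD addrACA subrr addr0 mulrBr.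
Qed.

Lemma PLo_linear_germ s f p : s = 1 \/ s = -1 -> f p = p -> linear_germ s p f.
Proof.
have [B fB] := pl_break (PLo_pl f).
have /andP[p0 p1] := unit_itvP p.
move=> sE fp; case: sE => ->.
- have [e e0 eB] := avoid_right B (set_val p).
  pose b := Num.min 1 (set_val p + e).
  have pb : set_val p <= b by rewrite le_min p1 lerDl ltW.
  have bE : set_val (clamp b) = b.
    by rewrite clampK // (le_trans p0 pb) ge_min lexx.
  have [|||m mf] := affine_fixed_linear (fB p (clamp b) _ _) _ fp.
  + by rewrite bE.
  + move=> t /eB; apply: contra => /andP[->]; rewrite bE lt_min.
    by case/andP.
  + by rewrite bE lexx.
  exists m, e; split=> // x; rewrite mul1r => /andP[px xe]; apply: mf.
  rewrite -subr_ge0 px bE le_min; case/andP: (unit_itvP x) => _ -> /=.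
  by rewrite -lerBlDl ltW.
- have [e e0 eB] := avoid_left B (set_val p).
  pose b := Num.max 0 (set_val p - e).
  have pb : b <= set_val p by rewrite ge_max p0 gerBl ltW.
  have bE : set_val (clamp b) = b.
    by rewrite clampK // (le_trans pb p1) le_max lexx.
  have [|||m mf] := affine_fixed_linear (fB (clamp b) p _ _) _ fp.
  + by rewrite bE.
  + move=> t /eB; apply: contra => /andP[+ ->]; rewrite bE gt_max andbT.
    by case/andP.
  + by rewrite bE lexx andbT.
  exists m, e; split=> // x; rewrite mulN1r opprB => /andP[px xe]; apply: mf.
  rewrite -(subr_ge0 (set_val x)) px andbT bE ge_max.
  by case/andP: (unit_itvP x) => -> _ /=; rewrite lerBlDr -lerBlDl ltW.
Qed.

Lemma PLo_side (s : R) f p x : s = 1 \/ s = -1 -> f p = p ->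
  0 <= s * (set_val x - set_val p) -> 0 <= s * (set_val (f x) - set_val p).
Proof.
move=> sE fp; rewrite -{2}fp.
case: sE => ->; first by rewrite !mul1r !subr_ge0 PLo_le.
by rewrite !mulN1r !opprB !subr_ge0 PLo_le.
Qed.

(** On the chosen side of [p], both composites are linear with slope [m * n]. *)
Lemma germs_commute (s : R) f g p : s = 1 \/ s = -1 -> f p = p -> g p = p ->
  exists2 e, 0 < e & forall x, 0 <= s * (set_val x - set_val p) < e ->
    f (g x) = g (f x).
Proof.
move=> sE fp gp.
have [m [e [e0 fe]]] := PLo_linear_germ sE fp.
have [n [e' [e'0 ge]]] := PLo_linear_germ sE gp.
have small (a b c : R) : 0 < b -> 0 <= a < b / (`|c| + 1) -> c * a < b.
  move=> b0 /andP[a0]; rewrite ltr_pdivlMr ?ltr_wpDl //.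
  apply: le_lt_trans; rewrite mulrC ler_wpM2l //.
  by rewrite (le_trans (ler_norm c)) // lerDl.
(* The last two bounds keep [g x] and [f x] in the range where [f] and [g] are
   linear. *)
pose d := Num.min (Num.min e e') (Num.min (e / (`|n| + 1)) (e' / (`|m| + 1))).
exists d.
  by rewrite !lt_min e0 e'0 !divr_gt0 // ltr_wpDl.
move=> x /andP[x0]; rewrite !lt_min => /andP[/andP[xe xe'] /andP[xn xm]].
have fx : set_val (f x) - set_val p = m * (set_val x - set_val p).
  by apply: fe; rewrite x0.
have gx : set_val (g x) - set_val p = n * (set_val x - set_val p).
  by apply: ge; rewrite x0.
have gx_near : 0 <= s * (set_val (g x) - set_val p) < e.
  by rewrite PLo_side // andTb gx mulrCA small // x0.
have fx_near : 0 <= s * (set_val (f x) - set_val p) < e'.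
  by rewrite PLo_side // andTb fx mulrCA small // x0.
apply/val_inj/(@addIr _ (- set_val p)).
by rewrite [LHS]fe // [RHS]ge // gx fx !mulrA (mulrC n).
Qed.

(** The elements of [H] which are the identity on a neighbourhood of every
    common fixed point of [H]. *)
Definition trivial_germs H : set (PLo R) :=
  [set h | H h /\ forall p, fixed_points H p ->
    exists2 e, 0 < e & forall x, `|set_val x - set_val p| < e -> h x = x].

Lemma trivial_germs_subgroup H : subgroup H -> subgroup (trivial_germs H).
Proof.
move=> /subgroupP[H1 HV HM]; apply/subgroupP; split.
- by split=> // p _; exists 1.
- move=> h [Hh th]; split; first exact: HV.
  by move=> p /th[e e0 he]; exists e => // x /he; exact: PLo_fixV.
- move=> f g [Hf tf] [Hg tg]; split; first exact: HM.
  move=> p Fp; have [e e0 fe] := tf p Fp; have [e' e'0 ge] := tg p Fp.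
  exists (Num.min e e'); first by rewrite lt_min e0.
  by move=> x; rewrite lt_min PLo_mulE => /andP[xe xe']; rewrite ge // fe.
Qed.

Lemma derived_trivial_germs H : subgroup H ->
  derived_subgroup H `<=` trivial_germs H.
Proof.
move=> gH; apply: derived_subgroup_min; first exact: trivial_germs_subgroup.
move=> f g Hf Hg; split; first exact: subgroup_commg.
move=> p Fp.
have [e e0 he] := @germs_commute 1 f g p (or_introl erefl) (Fp _ Hf) (Fp _ Hg).
have [e' e'0 he'] :=
  @germs_commute (-1) f g p (or_intror erefl) (Fp _ Hf) (Fp _ Hg).
exists (Num.min e e'); first by rewrite lt_min e0.
move=> x; rewrite lt_min => /andP[xe xe'].
have fg : f (g x) = g (f x).
  have [px|xp] := leP (set_val p) (set_val x).
    by apply: he; rewrite mul1r subr_ge0 px (le_lt_trans (ler_norm _)).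
  apply: he'; rewrite mulN1r opprB subr_ge0 (ltW xp) /=.
  by rewrite (le_lt_trans _ xe') // distrC ler_norm.
by rewrite /commg /conjg !PLo_mulE fg !PLo_VK.
Qed.

(** * Lifting elements one step up the derived series *)

(** On the interval [[c1, d1]] the maps [v] and [w] agree, and they preserve
    this interval. *)
Definition agree_on c1 d1 v w : Prop :=
  [/\ w c1 = c1, w d1 = d1 & forall x,
    set_val c1 <= set_val x <= set_val d1 -> v x = w x].

Lemma agree_onV c1 d1 v w :
  agree_on c1 d1 v w -> agree_on c1 d1 (v^-1)%g (w^-1)%g.
Proof.
move=> [wc wd vw]; split; [exact: PLo_fixV|exact: PLo_fixV|move=> x xcd].
rewrite -{1}(PLo_KV w x) -vw ?PLo_VK //.
by rewrite -(PLo_le w c1) -(PLo_le w _ d1) PLo_KV wc wd.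
Qed.

Lemma agree_onM c1 d1 v v' w w' : agree_on c1 d1 v w ->
  agree_on c1 d1 v' w' -> agree_on c1 d1 (v * v')%g (w * w')%g.
Proof.
move=> [wc wd vw] [wc' wd' vw']; split; rewrite ?PLo_mulE ?wc' ?wd' //.
move=> x xcd; rewrite !PLo_mulE vw' // vw //.
by rewrite -{1}wc' -wd' !PLo_le.
Qed.

Lemma agree_on_commg c1 d1 v v' w w' : agree_on c1 d1 v w ->
  agree_on c1 d1 v' w' -> agree_on c1 d1 [~ v, v']%g [~ w, w']%g.
Proof.
move=> vw vw'; rewrite /commg /conjg.
by do !apply: agree_onM => //; exact: agree_onV.
Qed.

(** For every sufficiently large compact interval [[c1, d1]] between [c] and
    [d], if some [k] in [K] moves [[c1, d1]] off itself to the right, then [w]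
    agrees on [[c1, d1]] with an element of [D].  Asking this of all large
    intervals is what makes the property stable under products. *)
Definition lifts_to c d K D w : Prop :=
  exists c0 d0, [/\ set_val c < set_val c0, set_val d0 < set_val d &
    forall c1 d1, set_val c < set_val c1 <= set_val c0 ->
      set_val d0 <= set_val d1 < set_val d ->
      forall k, K k -> set_val d1 < set_val (k c1) ->
      exists2 v, D v & agree_on c1 d1 v w].

(** A binary operation compatible with [agree_on] is compatible with
    [lifts_to]: the smaller of the two [c0] and the larger of the two [d0]
    serve for the result. *)
Lemma lifts_to2 c d K D1 D2 D w1 w2 w :
  (forall c1 d1 v1 v2, D1 v1 -> D2 v2 -> agree_on c1 d1 v1 w1 ->
     agree_on c1 d1 v2 w2 -> exists2 v, D v & agree_on c1 d1 v w) ->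
  lifts_to c d K D1 w1 -> lifts_to c d K D2 w2 -> lifts_to c d K D w.
Proof.
move=> comb [c0 [d0 [cc0 dd0 h]]] [c0' [d0' [cc0' dd0' h']]].
have [c2 [cc2 c2c0 c2c0']] : exists c2 : I, [/\ set_val c < set_val c2,
    set_val c2 <= set_val c0 & set_val c2 <= set_val c0'].
  by have [le|/ltW le] := leP (set_val c0) (set_val c0');
    [exists c0|exists c0'].
have [d2 [dd2 d2d0 d2d0']] : exists d2 : I, [/\ set_val d2 < set_val d,
    set_val d0 <= set_val d2 & set_val d0' <= set_val d2].
  by have [le|/ltW le] := leP (set_val d0) (set_val d0');
    [exists d0'|exists d0].
exists c2, d2; split=> // c1 d1 /andP[cc1 c1c2] /andP[d2d1 d1d] k Kk kc.
have [||v1 Dv1 a1] := h c1 d1 _ _ k Kk kc.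
- by rewrite cc1 (le_trans c1c2).
- by rewrite d1d (le_trans _ d2d1).
have [||v2 Dv2 a2] := h' c1 d1 _ _ k Kk kc.
- by rewrite cc1 (le_trans c1c2).
- by rewrite d1d (le_trans _ d2d1).
exact: comb Dv1 Dv2 a1 a2.
Qed.

Lemma lifts_to_subgroup c d K D : set_val c < set_val d -> subgroup D ->
  subgroup (lifts_to c d K D).
Proof.
move=> cd /subgroupP[D1 DV DM]; apply/subgroupP; split.
- by exists d, c; split=> // c1 d1 _ _ k _ _; exists 1%g.
- move=> w Lw; apply: (lifts_to2 _ Lw Lw) => c1 d1 v _ Dv _ vw _.
  by exists (v^-1)%g; [exact: DV|exact: agree_onV].
- move=> w w'; apply: lifts_to2 => c1 d1 v v' Dv Dv' vw vw'.
  by exists (v * v')%g; [exact: DM|exact: agree_onM].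
Qed.

Lemma trivial_germs_right H h p : trivial_germs H h -> fixed_points H p ->
  set_val p < 1 -> exists2 q : I, set_val p < set_val q &
    forall x : I, set_val p <= set_val x <= set_val q -> h x = x.
Proof.
move=> [_ th] /th[e e0 he] p1; have /andP[p0 _] := unit_itvP p.
pose b := Num.min 1 (set_val p + e / 2).
have e2 : 0 < e / 2 by rewrite divr_gt0.
have pb : set_val p < b by rewrite lt_min p1 ltrDl.
have bE : set_val (clamp b) = b.
  by rewrite clampK // (ltW (le_lt_trans p0 pb)) ge_min lexx.
exists (clamp b); rewrite bE // => x /andP[px]; rewrite le_min => /andP[_ xe].
apply: he; rewrite ger0_norm ?subr_ge0 //.
rewrite ltrBlDl (le_lt_trans xe) // ltrD2l.
by rewrite ltr_pdivrMr // mulr_natr mulr2n ltrDl.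
Qed.

Lemma trivial_germs_left H h p : trivial_germs H h -> fixed_points H p ->
  0 < set_val p -> exists2 q : I, set_val q < set_val p &
    forall x : I, set_val q <= set_val x <= set_val p -> h x = x.
Proof.
move=> [_ th] /th[e e0 he] p0; have /andP[_ p1] := unit_itvP p.
pose b := Num.max 0 (set_val p - e / 2).
have e2 : 0 < e / 2 by rewrite divr_gt0.
have pb : b < set_val p by rewrite gt_max p0 gtrBl.
have bE : set_val (clamp b) = b.
  by rewrite clampK // (ltW (lt_le_trans pb p1)) le_max lexx.
exists (clamp b); rewrite bE // => x /andP[+ px]; rewrite ge_max => /andP[_ xe].
apply: he; rewrite distrC ger0_norm ?subr_ge0 //.
rewrite ltrBlDr -ltrBlDl (lt_le_trans _ xe) // ltrD2l ltrN2.
by rewrite ltr_pdivrMr // mulr_natr mulr2n ltrDl.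
Qed.

(** The element agreeing with [w] is [[~ w^-1, k]], the product of [w] and of
    the conjugate of [w^-1] by [k], which is supported off the interval. *)
Lemma trivial_germs_lift H K c d w :
  fixed_points H c -> fixed_points H d -> subgroup K -> K `<=` H ->
  set_val c < set_val d -> (K `&` trivial_germs H) w ->
  lifts_to c d K (derived_subgroup K) w.
Proof.
move=> Fc Fd gK KH cd [Kw Tw]; have /subgroupP[_ KV _] := gK.
have [|c0 cc0 hc] := trivial_germs_right Tw Fc.
  by apply: lt_le_trans cd _; case/andP: (unit_itvP d).
have [|d0 d0d hd] := trivial_germs_left Tw Fd.
  by apply: le_lt_trans cd; case/andP: (unit_itvP c).
exists c0, d0; split=> // c1 d1 /andP[cc1 c1c0] /andP[d0d1 d1d] k Kk kc1.
exists [~ w^-1, k]%g; first by apply: derived_subgroup_commg => //; exact: KV.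
split.
- by apply: hc; rewrite (ltW cc1).
- by apply: hd; rewrite d0d1 ltW.
move=> x /andP[c1x xd1].
(* [k x] lies in the region to the right of [d1], where [w] is trivial. *)
have wk : w (k x) = k x.
  apply: hd; apply/andP; split.
    by rewrite (le_trans d0d1) // (le_trans (ltW kc1)) // PLo_le.
  by rewrite -(Fd k) ?PLo_le ?(le_trans xd1) ?ltW //; exact: KH.
by rewrite /commg /conjg invgK !PLo_mulE (PLo_fixV wk) PLo_VK.
Qed.

(** The derived series of [K `&` trivial_germs H] agrees locally with that of
    [K], with the index shifted by one. *)
Lemma derived_series_lift H K c d m :
  fixed_points H c -> fixed_points H d -> subgroup K -> K `<=` H ->
  set_val c < set_val d ->
  derived_series (K `&` trivial_germs H) m `<=`
    lifts_to c d K (derived_series K m.+1).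
Proof.
move=> Fc Fd gK KH cd; elim: m => [|m IHm].
  by move=> w; exact: trivial_germs_lift.
apply: derived_subgroup_min.
  by apply: lifts_to_subgroup => //; exact: derived_series_subgroup.
move=> w w' /IHm Lw /IHm Lw'; apply: lifts_to2 Lw Lw'.
move=> c1 d1 v v' Dv Dv' vw vw'; exists [~ v, v']%g.
  exact: derived_subgroup_commg.
exact: agree_on_commg.
Qed.

(** Passing from [K] to [K `&` trivial_germs H] lowers the derived length. *)
Lemma derived_trivial_germs_eq1 n H K : subgroup H -> subgroup K -> K `<=` H ->
  (forall h, H h -> exists m, K (h ^+ m.+1)%g) ->
  derived_series K n.+1 `<=` [set 1%g] ->
  derived_series (K `&` trivial_germs H) n `<=` [set 1%g].
Proof.
move=> gH gK KH root K1 w Dw; apply: PLo_eq1 => x.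
have Hw : H w.
  have gKT := subgroupI gK (trivial_germs_subgroup gH).
  by have [/KH] := derived_series_sub gKT Dw.
have [Fx|nFx] := pselect (fixed_points H x); first exact: Fx.
have [c [d [Fc Fd /andP[cx xd] gap]]] := fixed_gap gH nFx.
have [c0 [d0 [cc0 d0d lift]]] :=
  derived_series_lift Fc Fd gK KH (lt_trans cx xd) Dw.
have [c1 [cc1 c1c0 c1x]] : exists c1 : I, [/\ set_val c < set_val c1,
    set_val c1 <= set_val c0 & set_val c1 <= set_val x].
  by have [le|/ltW le] := leP (set_val c0) (set_val x); [exists c0|exists x].
have [d1 [d1d d0d1 xd1]] : exists d1 : I, [/\ set_val d1 < set_val d,
    set_val d0 <= set_val d1 & set_val x <= set_val d1].
  by have [le|/ltW le] := leP (set_val d0) (set_val x); [exists x|exists d0].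
have [|k Kk kc1] := @orbit_passes K c1 d1 gK.
  move=> p /andP[c1p pd1] Fp; apply: (gap p).
    by rewrite (lt_le_trans cc1) // (le_lt_trans pd1).
  by move=> h /root[m Khm]; apply: (@PLo_fix_root h m); exact: Fp.
have [||v /K1 -> [_ _ vw]] := lift c1 d1 _ _ k Kk kc1.
- by rewrite cc1.
- by rewrite d0d1.
by rewrite -vw // c1x.
Qed.

(** A group of piecewise linear homeomorphisms each of whose elements has a
    positive power in a solvable subgroup [K] is solvable, with at most the
    derived length of [K]. *)
Lemma derived_series_root n H K : subgroup H -> subgroup K -> K `<=` H ->
  (forall h, H h -> exists m, K (h ^+ m.+1)%g) ->
  derived_series K n `<=` [set 1%g] -> derived_series H n `<=` [set 1%g].
Proof.
elim: n H K => [|n IHn] H K gH gK KH root K1.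
  move=> h /root[m /K1 hm]; apply: PLo_eq1 => x.
  by apply: (@PLo_fix_root h m); rewrite hm.
have gT := trivial_germs_subgroup gH.
rewrite derived_series_succ.
apply: subset_trans (derived_seriesS (derived_trivial_germs gH)) _.
apply: (IHn _ (K `&` trivial_germs H)) => //.
- exact: subgroupI.
- move=> h Th; have [m Khm] := root h Th.1; exists m; split=> //.
  have /subgroupP[_ _ TM] := gT.
  elim: m {Khm} => [//|m IHm]; rewrite expgS; exact: TM.
- exact: derived_trivial_germs_eq1.
Qed.

End FixedPoints.

Theorem corollary1p3 (R : realType) (H : set (PLo R)) :
  subgroup H -> virtually_solvable H -> solvable_group H.
Proof.
move=> gH [K [gK KH finK [n Kn]]]; exists n.
apply: subgroup_set1; first exact: derived_series_subgroup.
apply: (derived_series_root gH gK KH); first exact: finite_index_expg.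
by rewrite Kn.
Qed.
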